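(* For any positive integer $g$ and any integer $r\geq\max\left(\frac{g}{3}+1,\left\lfloor\frac{g+1}{2}\right\rfloor-14\right)$, it holds that $n_{g,r}\leq n_{g+1,r}$.
   Context: $\mathbb{N}_0$ is the set of non-negative integers. A numerical semigroup is a subset of $\mathbb{N}_0$ that is closed under addition, contains $0$, and has finite complement in $\mathbb{N}_0$. The elements of the complement are called gaps, the number of gaps is the genus, the largest gap is the Frobenius number, and the smallest non-zero element of the semigroup is its multiplicity. A numerical semigroup of genus $g$ is ordinary if its gaps are all in a row, i.e. it equals $\{0,g+1,g+2,\dots\}$; $\mathbb{N}_0$ (genus $0$) counts as ordinary. The ordinarization transform $\Lambda'$ of a non-ordinary numerical semigroup $\Lambda$ with Frobenius number $F$ and multiplicity $m$ is $(\Lambda\setminus\{m\})\cup\{F\}$, which is a numerical semigroup of the same genus; the ordinarization transform of an ordinary semigroup is itself. Put $\Lambda^{(0)}=\Lambda$ and $\Lambda^{(i)}=(\Lambda^{(i-1)})'$. The ordinarization number of $\Lambda$ is the smallest $i\geq 0$ such that $\Lambda^{(i)}$ is ordinary (such $i$ exists). $n_{g,r}$ denotes the number of numerical semigroups of genus $g$ and ordinarization number $r$ (it is $0$ if there are none, in particular for $r>\lfloor g/2\rfloor$). *)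

(* Defs.v *)
From HB Require Import structures.
From mathcomp Require Import all_boot all_order all_algebra finmap.
From mathcomp Require Import all_classical.

Set Implicit Arguments.
Unset Strict Implicit.
Unset Printing Implicit Defensive.

Import Order.TTheory GRing.Theory Num.Theory.

Local Open Scope classical_set_scope.
Local Open Scope nat_scope.

Definition gaps (S : set nat) : set nat := ~` S.

Definition numerical_semigroup (S : set nat) : Prop :=
  [/\ S 0, forall x y, S x -> S y -> S (x + y) & finite_set (gaps S)].

Definition genus (S : set nat) : nat := #|` fset_set (gaps S) |.

(* The value is the default 0 for the semigroup without gaps, to which
   ordinarization below does not apply it. *)
Definition frobenius (S : set nat) : nat :=
  xget 0 [set F | gaps S F /\ forall x, gaps S x -> x <= F].

Definition multiplicity (S : set nat) : nat :=
  xget 0 [set m | [/\ S m, m != 0 & forall x, S x -> x != 0 -> m <= x]].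

Definition ordinary (S : set nat) : Prop :=
  S = [set n | n = 0 \/ genus S < n].

Definition ordinarization (S : set nat) : set nat :=
  if pselect (ordinary S) then S
  else (S `\ multiplicity S) `|` [set frobenius S].

Definition is_ordinarization_number (S : set nat) (r : nat) : Prop :=
  ordinary (iter r ordinarization S) /\
  forall i, ordinary (iter i ordinarization S) -> r <= i.

Definition semigroups_of (g r : nat) : set (set nat) :=
  [set S | [/\ numerical_semigroup S, genus S = g
             & is_ordinarization_number S r]].

(* fset_set is the empty set on infinite sets; the cardinal below is the
   intended one by finite_semigroups_of. *)
Definition n_ (g r : nat) : nat := #|` fset_set (semigroups_of g r) |.

Lemma frobeniusP (S : set nat) : numerical_semigroup S -> gaps S !=set0 ->
  gaps S (frobenius S) /\ forall x, gaps S x -> x <= frobenius S.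
Proof.
move=> [_ _ finS] [a Sa].
have gE x : (x \in fset_set (gaps S)) = (x \in gaps S) by rewrite in_fset_set.
have ex : exists x, x \in fset_set (gaps S) by exists a; rewrite gE inE.
have bnd x : x \in fset_set (gaps S) -> x <= \max_(i <- fset_set (gaps S)) i.
  by move=> xS; rewrite (big_rem x)//= leq_maxl.
case: (ex_maxnP ex bnd) => F; rewrite gE inE => SF maxF.
apply: (@xgetPex _ 0 [set F | gaps S F /\ forall x, gaps S x -> x <= F]).
by exists F; split=> // x Sx; apply: maxF; rewrite gE inE.
Qed.

Lemma gaps_lt_double_genus (S : set nat) (x : nat) :
  numerical_semigroup S -> gaps S x -> x < (genus S).*2.
Proof.
move=> [_ addS finS] Sx; pose G : seq nat := fset_set (gaps S).
have GE y : (y \in G) = (y \in gaps S) by rewrite in_fset_set.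
have -> : (genus S).*2 = size (G ++ [seq x - y | y <- G]).
  by rewrite size_cat size_map addnn.
rewrite -[x.+1](size_iota 0); apply: uniq_leq_size (iota_uniq _ _) _ => y.
rewrite mem_iota /= add0n ltnS mem_cat => yx.
have [Sy|nSy] := pselect (S y); last by rewrite GE mem_set.
apply/orP; right; apply/mapP; exists (x - y); last by rewrite subKn.
by rewrite GE mem_set// => Sxy; apply: Sx; rewrite -(subnKC yx); exact: addS.
Qed.

Lemma multiplicityP (S : set nat) : numerical_semigroup S ->
  [/\ S (multiplicity S), multiplicity S != 0
    & forall x, S x -> x != 0 -> multiplicity S <= x].
Proof.
move=> SS.
have ex : exists m, (m \in S) && (m != 0).
  exists (genus S).*2.+1; rewrite andbT mem_set//; apply: contrapT.
  by move/(gaps_lt_double_genus SS); rewrite ltnNge leqnSn.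
case: (ex_minnP ex) => m /andP[/set_mem Sm m0] minm.
apply: (@xgetPex _ 0
  [set m | [/\ S m, m != 0 & forall x, S x -> x != 0 -> m <= x]]).
by exists m; split=> // x Sx x0; apply: minm; rewrite mem_set.
Qed.

Lemma finite_semigroups_of (g r : nat) : finite_set (semigroups_of g r).
Proof.
pose f (A : {set 'I_g.*2}) : set nat :=
  [set x | forall h : x < g.*2, Ordinal h \in A].
apply: (@sub_finite_set _ _ (f @` setT)); last first.
  by apply: finite_image; exact: finite_finset.
move=> S [SS gS _]; exists [set i : 'I_g.*2 | nat_of_ord i \in S]%SET => //.
apply/seteqP; split=> x /=; last by move=> Sx h; rewrite finset.inE mem_set.
move=> h; apply: contrapT => nSx.
have xg : x < g.*2 by rewrite -gS; exact: gaps_lt_double_genus.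
by move: (h xg); rewrite finset.inE => /set_mem.
Qed.

(* Main.v *)
From Stdlib Require Import BinNat.
Require Import Defs.
From mathcomp Require Import all_boot all_order all_algebra zify lra.

(** Write h for the integer part of g / 2 and gamma = h - r.

    Each ordinarization step trades one non-zero element at most g for one
    above g, so the ordinarization number of a numerical semigroup S of genus
    g is the number of its elements in [1, g] (ordinarization_numberP).  When
    g + 3 <= 3 r, these r elements are so many that they must all be even
    (small_elements_even).  Indeed S meets [0, 2g] in only g + 1 points,
    whereas a set of r + 1 integers usually has at least 3 r sums.  The
    exceptions to this form of Freiman's theorem come from Mann's theorem
    (mann_subgroup), applied modulo the largest element of S up to g: they
    are governed by a subgroup, and the fact that S is closed under addition
    leaves only the multiples of 2.

    Then r <= h, and S is made of the doubles of a semigroup W of genus gamma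
    and of odd numbers larger than g; up to translation and halving these form
    a set E of natural numbers that contains W and satisfies E + W = E, an
    ideal of W.  The pair (W, E) determines S, because the translation is
    forced by the genus.  Hence n_ g r is at most the number of pairs (W, E)
    with W of genus gamma (n_le_ideal_count); this number, ideal_count gamma,
    depends on gamma only.  Conversely the construction of S from (W, E) is
    still valid when g is replaced by g + 1, which gives
    ideal_count gamma' <= n_ g.+1 r (ideal_count_le_n) with
    gamma' = (g + 1) / 2 - r, equal to gamma or to gamma + 1.

    It remains to see that ideal_count n <= ideal_count n.+1 for n <= 13
    (ideal_count_le).  Every semigroup of genus n + 1 is obtained from exactly
    one of genus n, its parent, by removing an element larger than all the
    gaps, and every ideal of the parent is an ideal of the child.  So the
    inequality follows if the semigroups with several children outweigh the
    leaves of this tree, each weighted by its number of ideals.  That number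
    is at least 2 ^ (m - 1), where m is the multiplicity (ideals_lower), and
    at most the product, over the residues i modulo m, of one plus the number
    of gaps congruent to i (ideals_upper); with these bounds the comparison
    becomes a short computation over the tree up to depth 13. *)

Set Implicit Arguments.
Unset Strict Implicit.
Unset Printing Implicit Defensive.

(** * The tree of numerical semigroups, given by their lists of gaps *)

Definition indecomposable (G : seq nat) (x : nat) : bool :=
  all (fun a => (a \in G) || (x - a \in G)) (iota 1 x.-1).

(** Gap lists are decreasing, so that the parent of a semigroup in the tree is
    the tail of its list. *)
Definition gapseq (G : seq nat) : bool :=
  [&& sorted gtn G, 0 \notin G & all (indecomposable G) G].

(** The bound on x loses nothing: a gap of a semigroup of genus n is smaller
    than 2 n. *)
Definition children (G : seq nat) : seq nat :=
  [seq x <- iota (head 0 G).+1 ((size G).*2.+1 - head 0 G) | indecomposable G x].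

Fixpoint gapseqs (n : nat) : seq (seq nat) :=
  if n is n'.+1 then [seq x :: G | G <- gapseqs n', x <- children G]
  else [:: [::]].

Lemma indecomposableP G x :
  reflect (forall a, 0 < a < x -> (a \in G) || (x - a \in G))
          (indecomposable G x).
Proof.
apply: (iffP allP) => H a.
  by move=> ax; apply: H; rewrite mem_iota; case: x ax => //= x; lia.
by rewrite mem_iota => ax; apply: H; move: ax; case: x => //= x; lia.
Qed.

Lemma eq_indecomposable G G' x : (forall a, a < x -> (a \in G) = (a \in G')) ->
  indecomposable G x = indecomposable G' x.
Proof.
move=> e; apply: eq_in_all => a; rewrite mem_iota => ax.
by rewrite !e//; case: x ax {e} => [|x] /=; lia.
Qed.

Lemma gtn_sorted_uniq G : sorted gtn G -> uniq G.
Proof.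
by apply: sorted_uniq; [move=> a b c /= ? ?; lia | move=> a /=; lia].
Qed.

Lemma path_gtnE x G : path gtn x G = all (gtn x) G && sorted gtn G.
Proof. by apply: path_sortedE => a b c /= ? ?; lia. Qed.

Lemma gtn_sorted_eq G G' : sorted gtn G -> sorted gtn G' -> G =i G' -> G = G'.
Proof.
by apply: irr_sorted_eq; [move=> a b c /= ? ?; lia | move=> a /=; lia].
Qed.

Lemma gapseq_cons x G : gapseq (x :: G) = gapseq G && (x \in children G).
Proof.
rewrite /gapseq /children mem_filter mem_iota andbA.
have -> : sorted gtn (x :: G) && (0 \notin x :: G) =
    [&& sorted gtn G, 0 \notin G & head 0 G < x].
  rewrite /= inE negb_or; case: G => [|y G] /=; first by lia.
  by rewrite inE negb_or; case: (path _ _ _); lia.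
rewrite /= -!andbA; case sG: (sorted gtn G) => //=; case nG: (0 \notin G) => //=.
case hx: (head 0 G < x); rewrite /= ?andbF //.
have lt_x y : y \in G -> y < x.
  case: G sG hx {nG} => [|z G]//=; rewrite path_gtnE => /andP[/allP zG _] zx.
  by rewrite inE => /predU1P[->//|/zG /= ?]; lia.
have eG y : y <= x -> indecomposable (x :: G) y = indecomposable G y.
  move=> yx; apply: eq_indecomposable => a ay; rewrite inE.
  by case: eqP => // ax; lia.
rewrite eG//.
have -> : all (indecomposable (x :: G)) G = all (indecomposable G) G.
  by apply: eq_in_all => y /lt_x yx; apply: eG; lia.
rewrite andbC; congr (_ && _).
case iG : (indecomposable G x) => //=; symmetry.
(* of a and x - a, at least one is a gap *)
suff: x.-1 <= (size G).*2 by lia.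
have -> : (size G).*2 = size (G ++ [seq x - y | y <- G]).
  by rewrite size_cat size_map addnn.
rewrite -(size_iota 1 x.-1); apply: uniq_leq_size (iota_uniq _ _) _ => a.
rewrite mem_iota => ax; have {ax}ax : 0 < a < x by lia.
have /indecomposableP/(_ a ax) := iG.
rewrite mem_cat => /orP[->//|xa]; apply/orP; right.
by apply/mapP; exists (x - a) => //; lia.
Qed.

Lemma mem_gapseqs n G : (G \in gapseqs n) = gapseq G && (size G == n).
Proof.
elim: n G => [|n IH] G; first by rewrite inE -size_eq0; case: G => [|x G]/=; rewrite ?andbF.
apply/idP/idP.
  case/allpairsPdep=> H [x [HG xH ->]].
  by move: HG; rewrite IH gapseq_cons xH andbT /= eqSS.
case: G => [|x G]; rewrite ?andbF// gapseq_cons /= eqSS -andbA => /and3P[gG xG sG].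
by apply: allpairs_f_dep => //; rewrite IH gG.
Qed.

Lemma gapseqs_uniq n : uniq (gapseqs n).
Proof.
elim: n => //= n IH; apply: allpairs_uniq_dep => //.
- by move=> G _; apply: filter_uniq; apply: iota_uniq.
- by case=> [G x] [H y] _ _ /= [-> ->].
Qed.

(** * Ideals of a numerical semigroup *)

(** With R = G and c = predT, the sets A of gaps such that A and the complement
    of G together form an ideal of that complement.  The gaps of R are examined
    from the largest one; rejecting b forbids every a for which b - a is not a
    gap, and c records what is still allowed. *)
Fixpoint ideals (G R : seq nat) (c : pred nat) : seq (seq nat) :=
  if R is b :: R' then
    (if c b then [seq b :: A | A <- ideals G R' c] else [::])
      ++ ideals G R' (fun a => c a && (b - a \in G))
  else [:: [::]].

Lemma idealsP G R (c : pred nat) A : sorted gtn R ->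
  reflect [/\ subseq A R, {in A, forall a, c a}
    & forall b a, b \in R -> b \notin A -> a \in A -> a < b -> b - a \in G]
  (A \in ideals G R c).
Proof.
elim: R c A => [|b R IH] c A sR.
  rewrite /= inE; apply: (iffP eqP) => [->//|[]]; by rewrite -?subseq0 => /eqP.
move: (sR); rewrite /= path_gtnE => /andP[/allP Rb /[dup] sR' /IH {}IH].
have bR : b \notin R by apply/negP => /Rb /=; lia.
rewrite mem_cat; apply: (iffP orP).
  case=> [|/IH[AR cA upA]].
    case: ifP => // cb /mapP[B /IH[BR cB upB] ->]; split.
    - by rewrite /= eqxx.
    - by move=> a; rewrite inE => /predU1P[->//|/cB].
    - move=> y a; rewrite !inE negb_or => /predU1P[->|yR]; first by rewrite eqxx.
      case/andP=> yb yB /predU1P[->|aB] ay; last exact: upB.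
      by move: (Rb _ yR) => /=; lia.
  split.
  - exact: subseq_trans AR (subseq_cons _ _).
  - by move=> a /cA /andP[].
  - by move=> y a; rewrite inE => /predU1P[-> _ /cA/andP[]|] //; apply: upA.
case=> AR cA upA; case bA: (b \in A).
  left; case: A AR cA upA bA => // a A AR cA upA.
  case: (eqVneq a b) AR cA upA => [->|ab] AR cA upA bA; last first.
    by move: AR => /mem_subseq/(_ b bA); rewrite (negbTE bR).
  rewrite cA ?mem_head//; apply/mapP; exists A => //; apply/IH.
  split => //.
    by move=> x xA; apply: cA; rewrite inE xA orbT.
  move=> y x yR yA xA; apply: upA; rewrite inE ?yR ?xA ?orbT// negb_or yA andbT.
  by apply: contraNneq bR => <-.
right; apply/IH.
have AR' : subseq A R.
  case: A AR {cA upA} bA => [|a A]; first by rewrite sub0seq.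
  by rewrite /= inE eq_sym; case: eqP.
split => //.
  move=> a aA; rewrite cA//=; apply: (upA b); rewrite ?mem_head ?bA//.
  by have /= := Rb _ (mem_subseq AR' aA).
by move=> y a yR; apply: upA; rewrite inE yR orbT.
Qed.

Lemma ideals_uniq G R (c : pred nat) : sorted gtn R -> uniq (ideals G R c).
Proof.
elim: R c => //= b R IH c; rewrite path_gtnE => /andP[/allP Rb sR].
rewrite cat_uniq IH// andbT; apply/andP; split.
  by case: ifP => // _; rewrite map_inj_uniq ?IH// => x y [].
case: ifP => _; last by apply/hasPn.
apply/hasPn => A /(idealsP _ _ _ sR)[/mem_subseq AR _ _].
apply/negP=> /mapP[B _ AE]; have /AR/Rb /= : b \in A by rewrite AE mem_head.
by lia.
Qed.

Definition gaps_multiplicity (G : seq nat) : nat :=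
  (find [pred i | i \notin G] (iota 1 (size G).+1)).+1.

Lemma gaps_multiplicityP G :
  gaps_multiplicity G \notin G /\ (forall a, 0 < a < gaps_multiplicity G -> a \in G).
Proof.
set s := iota 1 (size G).+1.
(* s has more entries than G *)
have H : has [pred i | i \notin G] s.
  apply/negPn/negP => /hasPn sG.
  have /uniq_leq_size : uniq s by apply: iota_uniq.
  move=> /(_ G); rewrite size_iota ltnn => F; apply: notF; apply: F => x xs.
  by have /= := sG _ xs; rewrite negbK.
have lt_f : find [pred i | i \notin G] s < (size G).+1.
  by move: H; rewrite has_find size_iota.
split.
  by have := nth_find 0 H; rewrite nth_iota.
move=> a am; have := @before_find _ 0 [pred i | i \notin G] s a.-1.
rewrite /gaps_multiplicity -/s in am; rewrite nth_iota; last by lia.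
rewrite add1n prednK; last by case/andP: am.
by case/andP: am => a0 am H'; apply/negbFE/H'; exact: am.
Qed.

Lemma gapseq_sub G x y : gapseq G -> x \in G -> 0 < y < x -> y \notin G ->
  x - y \in G.
Proof.
by case/and3P=> _ _ /allP iG /iG /indecomposableP xG /xG /orP[->|].
Qed.

Lemma gaps_multiplicity_mul G k : gapseq G -> k * gaps_multiplicity G \notin G.
Proof.
move=> gG; have [mG _] := gaps_multiplicityP G; elim: k => [|k IH]; first by case/and3P: gG.
apply: contra IH => kG; case: k kG => [|k] kG; first by move: mG; rewrite -[gaps_multiplicity G]mul1n kG.
suff: k.+2 * gaps_multiplicity G - gaps_multiplicity G \in G by rewrite mulSn addKn.
by apply: gapseq_sub => //; rewrite /gaps_multiplicity !mulSn; lia.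
Qed.

(** For m at most the multiplicity: all the gaps from m on, together with any set of gaps
    below m, make an ideal. *)
Lemma ideals_lower G R (c : pred nat) m : sorted gtn R -> (forall a, 0 < a < m -> a \in G) ->
  (forall x, x \in R -> m <= x -> c x) ->
  2 ^ count (fun x => (x < m) && c x) R <= size (ideals G R c).
Proof.
move=> + mG; elim: R c => //= b R IH c; rewrite path_gtnE => /andP[/allP Rb sR] cR.
rewrite size_cat; case: (ltnP b m) => bm /=; last first.
  rewrite cR ?mem_head// size_map add0n; apply: leq_trans (leq_addr _ _).
  by apply: IH => // x xR; apply: cR; rewrite inE xR orbT.
have lem c' : 2 ^ count (fun x => (x < m) && c' x) R <= size (ideals G R c').
  by apply: IH => // x /Rb /=; lia.
have := lem (fun a => c a && (b - a \in G)).
have -> : count (fun x => [&& x < m, c x & b - x \in G]) R =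
          count (fun x => (x < m) && c x) R.
  apply: eq_in_count => x /Rb /= xb; rewrite (_ : b - x \in G) ?andbT//.
  by apply: mG; lia.
case: ifP => cb /=; rewrite ?add0n// size_map expnS.
by have := lem c; lia.
Qed.

(** An ideal is stable under adding the element m of the semigroup, so it meets
    each residue class modulo m in a final segment of the gaps of that class. *)
Lemma ideals_upper G R (c : pred nat) m : 0 < m -> sorted gtn R ->
  (forall k, k * m \notin G) ->
  size (ideals G R c) <=
    \prod_(0 <= i < m) (count (fun x => c x && (x %% m == i)) R).+1.
Proof.
move=> m0 + mG; elim: R c => /= [|b R IH] c; first by rewrite big1.
rewrite path_gtnE => /andP[/allP Rb sR]; rewrite size_cat.
have bm : b %% m \in index_iota 0 m by rewrite mem_index_iota ltn_mod.
set N := fun i => count (fun x => c x && (x %% m == i)) R.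
set N' := fun i => count (fun x => (c x && (b - x \in G)) && (x %% m == i)) R.
have N'N i : N' i <= N i by apply: sub_count => x /andP[/andP[-> _] ->].
have N'0 : N' (b %% m) = 0.
  apply/eqP; rewrite -leqn0 leqNgt -has_count; apply/hasPn => x /Rb /= xb.
  apply/negP=> /andP[/andP[_ +] /eqP xm].
  rewrite (divn_eq b m) (divn_eq x m) xm subnDr -mulnBl; exact/negP.
have ub2 := IH (fun a => c a && (b - a \in G)) sR.
case cb: (c b); rewrite /= ?size_map ?add0n; last first.
  by apply: leq_trans ub2 _; apply: leq_prod => i _; rewrite add0n ltnS; apply: N'N.
have := leq_add (IH c sR) ub2; move/leq_trans; apply.
rewrite !(bigD1_seq _ bm) ?iota_uniq//= eqxx.
rewrite -/(N _) -/(N' _) N'0 mul1n.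
under [X in _ <= _ * X]eq_bigr => i ib do rewrite eq_sym (negbTE ib) add0n -/(N i).
rewrite add1n mulSn addnC leq_add// leq_prod// => i _; exact: N'N.
Qed.

(** * Growth of the number of ideals *)

Definition ideal_count (n : nat) : nat :=
  \sum_(G <- gapseqs n) size (ideals G G predT).

(** An ideal of the parent contains x, which becomes a gap of the child. *)
Lemma ideals_cons x G : gapseq (x :: G) ->
  size (ideals G G predT) <= size (ideals (x :: G) (x :: G) predT).
Proof.
move=> /and3P[sxG _ _]; move: (sxG); rewrite /= path_gtnE => /andP[/allP Gx sG].
rewrite -(size_map (cons x)).
apply: uniq_leq_size; first by rewrite map_inj_uniq ?ideals_uniq// => ? ? [].
move=> _ /mapP[A /(idealsP _ _ _ sG)[AG _ upA] ->].
apply/(@idealsP (x :: G) (x :: G) predT (x :: A) sxG); split=> [|//|b a]; first by rewrite /= eqxx.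
rewrite !inE negb_or => /predU1P[->|bG]; first by rewrite eqxx.
case/andP=> _ bA /predU1P[->|aA] ab; first by have /= := Gx _ bG; lia.
by rewrite (upA b a) ?orbT.
Qed.

Lemma ideal_countS n :
  \sum_(G <- gapseqs n) size (children G) * size (ideals G G predT)
    <= ideal_count n.+1.
Proof.
rewrite /ideal_count /= big_allpairs_dep /= big_seq [leqRHS]big_seq.
apply: leq_sum => G; rewrite mem_gapseqs => /andP[gG _].
rewrite -sum1_size big_distrl /= big_seq [leqRHS]big_seq.
by apply: leq_sum => x xG; rewrite mul1n ideals_cons// gapseq_cons gG.
Qed.

Definition ideal_bound G :=
  foldr muln 1 [seq (count (fun x => x %% gaps_multiplicity G == i) G).+1
    | i <- iota 0 (gaps_multiplicity G)].

(** Sums are computed in binary, since they reach several hundred thousand. *)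
Definition Nsum (F : seq nat -> nat) (s : seq (seq nat)) : N :=
  foldr (fun G acc => N.add (bin_of_nat (F G)) acc) N0 s.

(** In leq_ideal_countS a leaf counts its ideals on the left only, and a vertex
    with e > 0 children has an excess of e - 1 times its ideals on the right; the
    loss bounds the former from above and the gain the latter from below. *)
Definition loss (G : seq nat) : nat :=
  if children G is [::] then ideal_bound G else 0.

Definition gain (G : seq nat) : nat := (size (children G)).-1 * 2 ^ (gaps_multiplicity G).-1.

Lemma ideals_le_bound G : gapseq G -> size (ideals G G predT) <= ideal_bound G.
Proof.
move=> gG; have sG : sorted gtn G by case/and3P: gG.
have := @ideals_upper G G predT (gaps_multiplicity G) isT sG (fun k => gaps_multiplicity_mul k gG).
by rewrite /ideal_bound foldrE big_map /index_iota subn0.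
Qed.

Lemma ideals_ge_pow G : gapseq G -> 2 ^ (gaps_multiplicity G).-1 <= size (ideals G G predT).
Proof.
case/and3P=> sG nG _; have [_ mG] := gaps_multiplicityP G.
apply: leq_trans (@ideals_lower G G predT (gaps_multiplicity G) sG mG _) => //.
rewrite leq_exp2l// -(size_iota 1 (gaps_multiplicity G).-1) -size_filter.
apply: uniq_leq_size (iota_uniq _ _) _ => a; rewrite mem_iota => am.
by rewrite mem_filter /= andbT mG; rewrite /gaps_multiplicity in am *; lia.
Qed.

Lemma nat_of_bin_add (p q : N) : N.add p q = p + q :> nat.
Proof. by case: p q => [|p] [|q]; rewrite //= ?addn0// nat_of_add_pos. Qed.

Lemma NsumE F s : Nsum F s = \sum_(G <- s) F G :> nat.
Proof.
rewrite /Nsum; elim: s => [|G s IH] /=; first by rewrite big_nil.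
by rewrite big_cons nat_of_bin_add bin_of_natK IH.
Qed.

Lemma leq_ideal_countS n :
  Nsum loss (gapseqs n) <= Nsum gain (gapseqs n) ->
  ideal_count n <= ideal_count n.+1.
Proof.
rewrite !NsumE => LG; apply: leq_trans (ideal_countS n).
rewrite -(leq_add2r (\sum_(G <- gapseqs n) gain G)).
apply: leq_trans (leq_add (leqnn _) LG).
rewrite -!big_split /= big_seq [leqRHS]big_seq; apply: leq_sum => G.
rewrite mem_gapseqs /loss /gain => /andP[gG _].
have := ideals_le_bound gG; have := ideals_ge_pow gG.
case: (children G) => [|x s] /=; first by rewrite addn0.
by move=> up _; rewrite addn0 mulSn leq_add2l leq_mul2l up orbT.
Qed.

Lemma ideal_count_le n : n <= 13 -> ideal_count n <= ideal_count n.+1.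
Proof.
move=> n13; apply: leq_ideal_countS.
have : all (fun n => N.leb (Nsum loss (gapseqs n)) (Nsum gain (gapseqs n))) (iota 0 14).
  by vm_compute.
move/allP/(_ n); rewrite mem_iota add0n ltnS n13 => /(_ isT).
by move/N.leb_le; lia.
Qed.

(** * Mann's theorem in finite abelian groups *)

Import GRing.Theory.

Section Sumset.
Local Open Scope ring_scope.
Variables (V : finZmodType) (S : {set V}).

Definition sumset (X : {set V}) : {set V} := [set x + s | x in X, s in S].

Lemma sumsetP (X : {set V}) y : reflect (exists2 x, x \in X & y - x \in S) (y \in sumset X).
Proof.
apply: (iffP imset2P) => [[x s xX sS ->]|[x xX yS]].
  by exists x => //; rewrite addrC addKr.
by exists x (y - x) => //; rewrite addrC subrK.
Qed.

Lemma sub_sumset (X : {set V}) : 0 \in S -> X \subset sumset X.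
Proof. by move=> S0; apply/subsetP => x xX; apply/sumsetP; exists x; rewrite ?subrr. Qed.

Lemma sumsetS (X Y : {set V}) : X \subset Y -> sumset X \subset sumset Y.
Proof. by move=> XY; apply: imset2S. Qed.

(** Submodularity: a sumset distributes over unions, and the sumset of an
    intersection lies in the intersection of the sumsets. *)
Lemma card_sumset_setUI (X Y : {set V}) :
  (#|sumset (X :|: Y)| + #|sumset (X :&: Y)| <= #|sumset X| + #|sumset Y|)%N.
Proof.
rewrite -[leqRHS]cardsUI; apply: leq_add.
  apply/subset_leq_card/subsetP => y /sumsetP[x]; rewrite in_setU in_setU.
  by case/orP=> xX yx; apply/orP; [left|right]; apply/sumsetP; exists x.
by apply/subset_leq_card; rewrite subsetI !sumsetS ?subsetIl ?subsetIr.
Qed.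

Definition translate (X : {set V}) (v : V) : {set V} := [set x + v | x in X].

Lemma mem_translate (X : {set V}) v y : (y \in translate X v) = (y - v \in X).
Proof.
apply/imsetP/idP => [[x xX ->]|yX]; first by rewrite addrK.
by exists (y - v); rewrite ?subrK.
Qed.

Lemma card_translate (X : {set V}) v : #|translate X v| = #|X|.
Proof. by rewrite card_imset//; exact: addIr. Qed.

Lemma sumset_translate (X : {set V}) v : sumset (translate X v) = translate (sumset X) v.
Proof.
apply/setP => y; rewrite mem_translate; apply/sumsetP/sumsetP => -[x xX yx].
  exists (x - v); first by rewrite -(mem_translate X).
  by rewrite opprB addrA subrK.
by exists (x + v); rewrite ?mem_translate ?addrK// opprD addrCA addrC.
Qed.

Definition proper_sumset (X : {set V}) := (X != set0) && (sumset X != setT).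

(** If some sumset X + S is smaller than |X| + |S| - 1, the excess
    |X + S| - |X| is minimal for some subgroup: among the sets of minimal
    excess take one, A, of minimal size, and translate it so that it contains
    0.  Two translates of A that meet must coincide, since otherwise their
    union or their intersection would contradict minimality; so A is closed
    under addition. *)
Theorem mann_subgroup (X : {set V}) : 0 \in S ->
  X != set0 -> sumset X != setT -> (#|sumset X| < #|X| + #|S| - 1)%N ->
  exists H : {set V}, [/\ 0 \in H, {in H &, forall x y, x + y \in H},
    sumset H != setT & (#|sumset H| < #|H| + #|S| - 1)%N].
Proof.
move=> S0 X0 XT XS.
pose k (Y : {set V}) := (#|sumset Y| - #|Y|)%N.
have kE Y : (#|sumset Y| = #|Y| + k Y)%N by rewrite subnKC// subset_leq_card ?sub_sumset.
have fX : proper_sumset X by rewrite /proper_sumset X0.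
(* minimizing w first minimizes the excess k, then the size *)
pose w Y := (k Y * #|V|.+1 + #|Y|)%N.
case: (arg_minnP w fX) => A0 /andP[A00 A0T] minA0.
have [a0 a0A] := set0Pn _ A00.
have lex Y Z : (w Y <= w Z -> (k Y < k Z) || (k Y == k Z) && (#|Y| <= #|Z|))%N.
  have num p q a b n : (b <= n -> p * n.+1 + a <= q * n.+1 + b ->
      (p < q) || (p == q) && (a <= b))%N.
    case: (ltngtP p q) => //= [qp|-> _]; last by rewrite leq_add2l.
    by have := leq_mul qp (leqnn n.+1); rewrite mulSn; lia.
  exact/num/max_card.
pose A := translate A0 (- a0).
have cA : #|A| = #|A0| by rewrite card_translate.
have kA : k A = k A0 by rewrite /k sumset_translate !card_translate.
have A_0 : 0 \in A by rewrite mem_translate opprK add0r.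
have AT : sumset A != setT.
  by apply: contraNneq A0T => AE; rewrite eqEcard subsetT -AE sumset_translate card_translate leqnn.
have minA Y : proper_sumset Y -> ((k A < k Y) || (k A == k Y) && (#|A| <= #|Y|))%N.
  by rewrite cA kA => /minA0/lex.
exists A; split => //; last first.
  by rewrite kE; have := minA _ fX; move: XS; rewrite kE; lia.
(* The dual of A, minus the complement of A + S, has excess at most k A, so it
   is at least as large as A. *)
have half : (2 * #|A| + k A <= #|V|)%N.
  pose D := [set - x | x in ~: sumset A].
  have cD : #|D| = (#|V| - #|A| - k A)%N.
    rewrite card_imset; last exact: oppr_inj.
    by rewrite -(cardsC (sumset A)) kE -subnDA addKn.
  have DA : sumset D \subset ~: [set - x | x in A].
    apply/subsetP => y /sumsetP[_ /imsetP[x + ->]]; rewrite !inE opprK => xA yx.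
    apply: contra xA => /imsetP[a aA yE]; apply/sumsetP; exists a => //.
    by rewrite addrC -yE.
  have cNA : #|[set - x | x in A]| = #|A| by rewrite card_imset//; exact: oppr_inj.
  have cDS : (#|sumset D| + #|A| <= #|V|)%N.
    by rewrite -cNA -(cardsC [set - x | x in A]) addnC leq_add2l subset_leq_card.
  have A1 : (0 < #|A|)%N by apply/card_gt0P; exists 0.
  have fD : proper_sumset D.
    apply/andP; split.
      have [y yA] : exists y, y \notin sumset A.
        apply/existsP; move: AT; apply: contraNT => /existsPn yA.
        by apply/eqP/setP => y; rewrite inE; have := yA y; rewrite negbK.
      by apply/set0Pn; exists (- y); apply/imset_f; rewrite inE.
    apply/eqP => DT; have : (#|V| <= #|sumset D|)%N by rewrite DT cardsT.
    by lia.
  have := minA _ fD; have := kE D; rewrite cD.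
  have : (#|A| + k A <= #|V|)%N by rewrite -kE max_card.
  lia.
(* A and its translate by h meet in h; by submodularity they must be equal. *)
move=> a h aA hA.
pose B := translate A h.
have cB : #|B| = #|A| by rewrite card_translate.
have kB : k B = k A by rewrite /k sumset_translate !card_translate.
suff AB : A = B by rewrite AB mem_translate addrK.
have hI : h \in A :&: B by rewrite inE hA mem_translate subrr.
apply/eqP; rewrite eqEcard cB leqnn andbT; apply/negPn/negP => nAB.
have ltI : (#|A :&: B| < #|A|)%N.
  rewrite ltn_neqAle subset_leq_card ?subsetIl// andbT; apply: contra nAB => /eqP e.
  by apply/setIidPl/eqP; rewrite eqEcard subsetIl e /=.
have kI : (k A < k (A :&: B))%N.
  have : proper_sumset (A :&: B).
    apply/andP; split; first by apply/set0Pn; exists h.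
    apply: contraNneq AT => e; rewrite eqEsubset subsetT -e sumsetS//.
    exact: subsetIl.
  by move/minA => /orP[//|/andP[_]]; rewrite leqNgt ltI.
have := card_sumset_setUI A B; rewrite !kE kB cB => ui.
have cUI := cardsUI A B; rewrite cB in cUI.
have kU : (k (A :|: B) < k A)%N by clearbody k; clear -ui cUI kI; lia.
have [UT|UT] := eqVneq (sumset (A :|: B)) setT.
  have : (#|V| <= #|A :|: B| + k (A :|: B))%N by rewrite -kE UT cardsT.
  by clearbody k; clear -ui cUI kI half; lia.
have /minA : proper_sumset (A :|: B).
  by apply/andP; split=> //; apply/set0Pn; exists h; rewrite inE hA.
by rewrite ltnNge (ltnW kU) gtn_eqF.
Qed.

End Sumset.

(** * Semigroups with many small elements *)

Lemma closed_mull (Q : pred nat) k x : Q 0 ->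
  (forall x y, Q x -> Q y -> Q (x + y)) -> Q x -> Q (k * x).
Proof. by move=> Q0 QD Qx; elim: k => // k; rewrite mulSn; exact: QD. Qed.

(** Adding x another a - 1 times subtracts it modulo a, so the least positive d in
    Q divides all of Q. *)
Lemma periodic_closed (Q : pred nat) a : 0 < a -> Q 0 ->
  (forall x y, Q x -> Q y -> Q (x + y)) -> (forall x, Q (x %% a) = Q x) ->
  exists d, [/\ 0 < d, d %| a & forall x, Q x = (d %| x)].
Proof.
move=> a0 Q0 QD Qa.
have Qaa : Q a by rewrite -Qa modnn.
have ex : exists d, (0 < d) && Q d by exists a; rewrite a0.
case: (ex_minnP ex) => d /andP[d0 Qd] dmin.
have QM k x : Q x -> Q (k * x) by exact: (@closed_mull Q k x Q0 QD).
have QE x : Q x = (d %| x).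
  apply/idP/idP => [Qx|/dvdnP[k ->]]; last exact: QM.
  have : Q (x %% d).
    rewrite -Qa -(modnMDl (x %/ d * d)).
    have -> : x %/ d * d * a + x %% d = x + a.-1 * (x %/ d * d).
      rewrite [X in _ = X + _](divn_eq x d); case: (a) a0 => // a' _ /=.
      by rewrite mulnS [a' * _]mulnC; lia.
    by rewrite Qa; apply: QD => //; rewrite mulnA; apply: QM.
  rewrite /dvdn; case: posnP => // xd Qxd.
  by have := dmin (x %% d); rewrite xd Qxd leqNgt ltn_mod d0 => /(_ isT).
by exists d; rewrite -QE.
Qed.

(** The sums x + y in which x is the least element of X or y is the largest one
    of Y. *)
Lemma sums_lower (X Y : seq nat) : uniq X -> uniq Y -> X != [::] -> Y != [::] ->
  exists Z, [/\ uniq Z, size Z = (size X + size Y).-1 &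
    forall z, z \in Z -> exists x y, [/\ x \in X, y \in Y & z = x + y]].
Proof.
move=> uX uY X0 Y0.
have exX : exists x, x \in X by case: X X0 {uX} => // x X _; exists x; rewrite mem_head.
have exY : exists x, x \in Y by case: Y Y0 {uY} => // x Y _; exists x; rewrite mem_head.
have bY y : y \in Y -> y <= \max_(y <- Y) y by move=> yY; rewrite (big_rem y)//= leq_maxl.
case: (ex_minnP exX) => x0 x0X minX; case: (ex_maxnP exY bY) => y1 y1Y maxY.
exists ([seq x0 + y | y <- Y] ++ [seq x + y1 | x <- rem x0 X]); split.
- rewrite cat_uniq !map_inj_uniq ?rem_uniq ?uY//=; try exact: addIn; try exact: addnI.
  rewrite andbT; apply/hasPn => _ /mapP[x + ->]; rewrite mem_rem_uniq// inE.
  case/andP=> xx0 xX; apply/negP => /mapP[y /maxY yy1].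
  by have := minX _ xX; move/eqP: xx0; lia.
- rewrite size_cat !size_map size_rem// addnC.
  by case: X X0 {uX exX minX x0X}.
- move=> z; rewrite mem_cat => /orP[/mapP[y yY ->]|/mapP[x + ->]].
    by exists x0, y.
  by move/mem_rem => xX; exists x, y1.
Qed.

Lemma card_ord_pred m (p : pred nat) : #|[set x : 'I_m | p x]| = count p (iota 0 m).
Proof.
rewrite -sum1_card -sum1_count (eq_bigl (fun x : 'I_m => p x)); last by move=> x; rewrite inE.
by rewrite -(big_mkord p (fun=> 1)) /index_iota subn0.
Qed.

Lemma count_dvdn e n : 0 < e -> count (dvdn e) (iota 1 n) = n %/ e.
Proof.
move=> e0; elim: n => [|n IH]; first by rewrite div0n.
rewrite -[n.+1]addn1 iotaD count_cat IH /= add1n addn0 addn1.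
by rewrite divnS// addnC.
Qed.

Lemma count_iota01 (p : pred nat) a : p 0 = p a ->
  count p (iota 0 a) = count p (iota 1 a).
Proof.
move=> pE; have E : iota 0 a ++ [:: a] = 0 :: iota 1 a.
  by rewrite -[[:: a]]/(iota (0 + a) 1) -iotaD addn1.
by have := congr1 (count p) E; rewrite count_cat /= pE; lia.
Qed.

Definition residue_hit (P : pred nat) (a d k : nat) : bool :=
  has (fun s => P s && (s == k %[mod d])) (iota 0 a).

Lemma residue_hitP (P : pred nat) a d k :
  reflect (exists s, [/\ s < a, P s & s = k %[mod d]]) (residue_hit P a d k).
Proof.
apply: (iffP hasP) => [[s]|[s [sa Ps sk]]].
  by rewrite mem_iota => sa /andP[Ps /eqP sk]; exists s.
by exists s; rewrite ?mem_iota// Ps; apply/eqP.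
Qed.

Lemma residue_hit_mod (P : pred nat) a d k l : k = l %[mod d] ->
  residue_hit P a d k = residue_hit P a d l.
Proof. by move=> kl; apply: eq_has => s; rewrite kl. Qed.

Lemma count_diff (p q : pred nat) s : {in s, forall x, p x -> q x} ->
  count q s = count p s + count (fun x => q x && ~~ p x) s.
Proof.
elim: s => //= x s IH pq; rewrite IH; last by move=> y ys; apply: pq; rewrite inE ys orbT.
have := pq x (mem_head _ _).
by case: (p x) => [->//|_]; case: (q x) => //=; lia.
Qed.

(** Let a be the largest element of P up to g and S the set of residues modulo a
    of the elements of P below a.  As [0, 2g] contains only g + 1 elements of
    P, |S + S| is less than 2 |S| - 1, and Mann's theorem provides a subgroup
    of Z/aZ, that is the multiples of a divisor d of a, such that P misses at
    most a / d - 2 of the numbers below a in the residue classes modulo d that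
    it meets, without meeting all the classes. *)
Lemma few_residues (P : pred nat) g r : P 0 ->
    (forall x y, P x -> P y -> P (x + y)) ->
    count P (iota 1 g) = r -> count P (iota 0 g.*2.+1) = g.+1 ->
    g + 3 <= 3 * r ->
  exists a d, [/\ [/\ 0 < a <= g, P a, forall x, x <= g -> P x -> x <= a &
      count P (iota 0 a) = r],
    0 < d, d %| a, count (residue_hit P a d) (iota 0 a) + 2 <= a %/ d + r &
    exists k, ~~ residue_hit P a d k].
Proof.
move=> P0 PD Pr Pg gr.
have g_gt0 : 0 < g by have := count_size P (iota 1 g); rewrite Pr size_iota; lia.
have [a [a0 ag Pa amax]] : exists a, [/\ 0 < a, a <= g, P a &
    forall x, x <= g -> P x -> x <= a].
  have bnd y : (y <= g) && P y -> y <= g by case/andP.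
  have ex : exists y, (y <= g) && P y by exists 0; rewrite P0.
  case: (ex_maxnP ex bnd) => a /andP[ag Pa] amax; exists a; split => //; last first.
    by move=> y yg Py; apply: amax; rewrite yg.
  have : has P (iota 1 g) by rewrite has_count Pr; lia.
  case/hasP => y; rewrite mem_iota => y1 Py.
  by have := amax y; rewrite Py andbT; lia.
have noP y : a < y <= g -> ~~ P y.
  by move=> yg; apply/negP => Py; have := amax y; rewrite Py; lia.
have cntr : count P (iota 0 a) = r.
  have : count P (iota 1 a) = r.
    rewrite -Pr -(subnKC ag) iotaD count_cat [X in _ + X](_ : _ = 0) ?addn0//.
    apply/eqP; rewrite -leqn0 leqNgt -has_count; apply/hasPn => y.
    by rewrite mem_iota => yg; apply: noP; lia.
  by rewrite count_iota01// P0 Pa.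
case: a => // n in a0 ag Pa amax noP cntr *; set a := n.+1 in ag Pa amax noP cntr.
pose S := [set s : 'I_a | P s].
have cS : #|S| = r by rewrite card_ord_pred.
have S0 : 0%R \in S by rewrite inE.
have shift (c : 'I_a) : c \in sumset S S -> P (c + a).
  case/sumsetP => s; rewrite !inE => Ps; set t := (c - s)%R => Pt.
  have -> : c = (t + s)%R by rewrite subrK.
  have tE : val (t + s)%R = (t + s) %% a by [].
  rewrite tE; have := ltn_ord s; have := ltn_ord t => ta sa.
  have Pts : P (t + s) by exact: PD.
  case: (ltnP (t + s) a) => tsa; first by rewrite modn_small//; exact: PD.
  by rewrite -(subnK tsa) modnDr modn_small ?subnK//; lia.
(* In [a, 2a) the residue c of a sum of two elements is represented by a + c. *)
have many : r + #|sumset S S| <= g.+1.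
  rewrite -Pg -(subnKC (_ : a + a <= g.*2.+1)); last by lia.
  rewrite !iotaD !count_cat cntr -addnA leq_add2l add0n; apply: leq_trans (leq_addr _ _).
  rewrite -[iota a a]/(iota (0 + a) a) addnC iotaDl count_map.
  rewrite -(card_ord_pred a (preim (addn a) P)); apply/subset_leq_card/subsetP => c /shift.
  by rewrite inE /= addnC.
(* Otherwise every number from a on would be in P, but r of the numbers in
   (g, 2g] are not. *)
have notfull : sumset S S != setT.
  apply/negP => /eqP ST.
  have Pbig y : a <= y -> P y.
    move=> ay; have c_lt : y %% a < a by rewrite ltn_mod.
    have : 0 < y %/ a by rewrite divn_gt0.
    rewrite {2}(divn_eq y a); case: (y %/ a) => // k _.
    rewrite mulSnr -addnA; apply: (PD); first exact: (closed_mull k P0 PD Pa).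
    by rewrite addnC; apply: (shift (Ordinal c_lt)); rewrite ST inE.
  have : count P (iota g.+1 g) = g.
    rewrite -[RHS](size_iota g.+1 g); apply/eqP; rewrite -all_count.
    by apply/allP => y; rewrite mem_iota => yg; apply: Pbig; lia.
  move: Pg; rewrite -addnn -addSn iotaD count_cat -[iota 0 g.+1]/(0 :: iota 1 g) /= P0 Pr.
  by rewrite add0n => h1 h2; move: h1 g_gt0 gr; rewrite h2; clear; lia.
have [||H [H0 HD HT HS]] := @mann_subgroup _ S S S0 _ notfull.
- by apply/set0Pn; exists 0%R.
- by rewrite cS; lia.
have [|||y|d [d0 da dH]] := @periodic_closed (fun k => (inZp k : 'I_a) \in H) a.
- by [].
- by have -> : inZp 0 = 0%R :> 'I_a by apply/val_inj.
- move=> x1 x2 H1 H2; have -> : inZp (x1 + x2) = (inZp x1 + inZp x2)%R :> 'I_a.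
    by apply/val_inj; rewrite /= modnDm.
  exact: HD.
- by congr (_ \in H); apply/val_inj; rewrite /= modn_mod.
have HE (y : 'I_a) : (y \in H) = (d %| y) by rewrite -dH valZpK.
pose h := a %/ d; have ahd : a = h * d by rewrite divnK.
have cH : #|H| = h.
  rewrite (_ : H = [set y : 'I_a | d %| y]); last by apply/setP => y; rewrite inE HE.
  rewrite card_ord_pred.
  by rewrite count_iota01 ?dvdn0 ?da// count_dvdn.
have sumR (y : 'I_a) : (y \in sumset S H) = residue_hit P a d y.
  have sub (u : 'I_a) : (y - u)%R + u = y %[mod d].
    have {2}-> : y = ((y - u) + u)%R by rewrite subrK.
    have -> : val ((y - u) + u)%R = ((y - u)%R + u) %% a by [].
    by rewrite modn_dvdm.
  apply/sumsetP/residue_hitP.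
    move=> [z zH]; rewrite inE; set s := (y - z)%R => Ps; exists s; split => //.
    rewrite -(sub z) -/s -modnDmr; move: zH; rewrite HE => /eqP ->.
    by rewrite addn0.
  case=> s [sa Ps sy]; exists (y - Ordinal sa)%R; last by rewrite inE opprB addrC subrK.
  rewrite HE /dvdn -[X in _ == X](mod0n d) -(eqn_modDr s) add0n sy; apply/eqP.
  exact: (sub (Ordinal sa)).
exists a, d; split=> //.
  rewrite -card_ord_pred -/h -cH -cS.
  have -> : [set y : 'I_a | residue_hit P a d y] = sumset S H.
    by apply/setP => y; rewrite inE sumR.
  by rewrite addn2; move: HS; rewrite ltn_subRL add1n.
have /existsP[y yH] : [exists y, y \notin sumset S H].
  apply: contraR HT => /existsPn yH.
  by apply/eqP/setP => y; rewrite inE; have := yH y; rewrite negbK.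
by exists y; rewrite -sumR.
Qed.

(** The elements of a class modulo d that are below the least element of P in
    that class are missing from P, and few numbers are missing from the classes
    that P meets; so the least elements of two such classes cannot both be
    large. *)
Lemma least_sum_lt (P : pred nat) a d r k l w v : 0 < d -> d %| a ->
    count P (iota 0 a) = r -> count (residue_hit P a d) (iota 0 a) + 2 <= a %/ d + r ->
    k != l %[mod d] -> w < a -> v < a -> w = k %[mod d] -> v = l %[mod d] ->
    residue_hit P a d k -> residue_hit P a d l ->
    (forall s, P s -> s = k %[mod d] -> w <= s) ->
    (forall s, P s -> s = l %[mod d] -> v <= s) -> w + v < a.
Proof.
move=> d0 da Pra few kl wa va wk vl Rk Rl wmin vmin.
pose R := residue_hit P a d; pose h := a %/ d; have ahd : a = h * d by rewrite divnK.
have R_mod x y : x = y %[mod d] -> R x = R y by exact: residue_hit_mod.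
have RE s : s < a -> P s -> R s by move=> sa Ps; apply/residue_hitP; exists s.
pose T := [seq w %% d + t * d | t <- iota 0 (w %/ d)] ++
          [seq v %% d + t * d | t <- iota 0 (v %/ d)].
have class (u t : nat) : u %% d + t * d = u %[mod d] by rewrite addnC modnMDl modn_mod.
have below (u t : nat) : t < u %/ d -> u %% d + t * d < u.
  move=> tu; rewrite {2}(divn_eq u d) addnC ltn_add2r ltn_mul2r d0; exact: tu.
have uT : uniq T.
  rewrite cat_uniq !map_inj_uniq ?iota_uniq//=; try by
    move=> t1 t2 /addnI /eqP; rewrite eqn_mul2r eqn0Ngt d0 => /eqP.
  rewrite andbT; apply/hasPn => _ /mapP[t _ ->]; apply/negP=> /mapP[t' _ e].
  by move/eqP: kl; apply; rewrite -wk -vl -(class w t') -(class v t) e.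
have sT : {subset T <= filter (fun s => R s && ~~ P s) (iota 0 a)}.
  move=> s; rewrite mem_cat mem_filter mem_iota add0n => /orP[] /mapP[t];
  rewrite mem_iota add0n => /below tu ->.
    have -> : R (w %% d + t * d) by rewrite (R_mod _ k) ?class.
    rewrite (ltn_trans tu wa) leq0n /= ?andbT; apply/negP => Ps.
    have := wmin _ Ps; rewrite class => /(_ wk).
    by rewrite leqNgt tu.
  have -> : R (v %% d + t * d) by rewrite (R_mod _ l) ?class.
  rewrite (ltn_trans tu va) leq0n /= ?andbT; apply/negP => Ps.
  have := vmin _ Ps; rewrite class => /(_ vl).
  by rewrite leqNgt tu.
have := uniq_leq_size uT sT; rewrite size_cat !size_map !size_iota size_filter.
have cR : {in iota 0 a, forall s, P s -> R s}.
  by move=> s; rewrite mem_iota => sa; apply: RE.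
move: few; rewrite -/R (count_diff cR) Pra -/h => few' leT.
have : w %/ d + v %/ d + 2 <= h.
  move: few'; rewrite -addnA addnC leq_add2r; apply: leq_trans.
  by rewrite leq_add2r.
move=> whv; have := ltn_ceil w d0; have := ltn_ceil v d0.
have := leq_mul whv (leqnn d); rewrite -ahd.
by move: (w %/ d) (v %/ d) => x y; rewrite !mulSn !mulnDl mul2n -addnn; clear; lia.
Qed.

(** A set R of residues modulo d that is closed under sums of distinct elements,
    and under doubling except for at most one element, is closed under sums,
    or contains no residue besides 0 and the exceptional one, i.  For a third
    residue k the whole coset i + <k> lies in R, and i + i is a sum of two
    distinct elements of it, or of i + k, i and k in case k + k = 0. *)
Lemma almost_closed (R : pred nat) d : 0 < d -> R 0 ->
    (forall k l, k = l %[mod d] -> R k = R l) ->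
    (forall k l, k != l %[mod d] -> R k -> R l -> R (k + l)) ->
    (forall k l, R k -> R l -> ~~ R (k + k) -> ~~ R (l + l) -> k = l %[mod d]) ->
  (forall k l, R k -> R l -> R (k + l)) \/
  exists i, [/\ R i, ~~ R (i + i) &
    forall k, R k -> k != 0 %[mod d] -> k = i %[mod d]].
Proof.
move=> d0 R0 R_mod distinctD bad_unique.
have [/existsP[i0 /andP[Ri Rii]]|/existsPn closed] :=
    boolP [exists i : 'I_d, R i && ~~ R (i + i)]; [right|left]; last first.
  move=> k l Rk Rl; case: (eqVneq (k %% d) (l %% d)) => [kl|?]; last exact: distinctD.
  have k_lt : k %% d < d by rewrite ltn_mod.
  have := closed (Ordinal k_lt); rewrite /= (R_mod _ k) ?modn_mod// Rk /= negbK.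
  by rewrite (R_mod _ (k + l)) // modnDm -[RHS]modnDmr -kl modnDmr.
move: Ri Rii; set i := nat_of_ord i0 => Ri Rii.
exists i; split=> // k Rk kn0; apply/eqP/negPn/negP => ki.
have Rkk : R (k + k).
  by apply/negPn/negP => /(bad_unique _ _ Rk Ri)/(_ Rii) /eqP; apply/negP.
have Rik n : R (i + n * k).
  elim: n => [|n IH]; first by rewrite mul0n addn0.
  rewrite mulSnr addnA; have [e|?] := eqVneq ((i + n * k) %% d) (k %% d); last exact: distinctD.
  by rewrite (R_mod _ (k + k))// -modnDml e modnDml.
have Rimk := Rik d.-1.
have dk : d.-1 * k + k = d * k by rewrite -mulSnr prednK.
(* i + i = (i - k) + (i + k) *)
have [e|ne] := eqVneq ((i + d.-1 * k) %% d) ((i + k) %% d); last first.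
  move/negP: Rii; apply; rewrite (R_mod _ (i + d.-1 * k + (i + k))); last first.
    by rewrite addnACA dk [d * k]mulnC [_ + k * d]addnC modnMDl.
  by apply: distinctD => //; have := Rik 1; rewrite mul1n.
have kk : k + k = 0 %[mod d].
  have ikk : i = i + k + k %[mod d].
    by rewrite -[RHS]modnDml -e modnDml -addnA dk [d * k]mulnC addnC modnMDl.
  by apply/eqP; rewrite -(eqn_modDl i) addn0 addnA -ikk.
have Rik1 : R (i + k) by have := Rik 1; rewrite mul1n.
have iki : i + k != i %[mod d] by rewrite -{2}[i]addn0 eqn_modDl.
have Riki := distinctD _ _ iki Rik1 Ri.
move/negP: Rii; apply; have [ii|ii] := eqVneq ((i + k + i) %% d) (k %% d).
  rewrite (R_mod _ 0)//; apply/eqP; rewrite -(eqn_modDr k) add0n -ii addnAC.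
  by rewrite eqxx.
have := distinctD _ _ ii Riki Rk; rewrite -(R_mod (i + i))//.
have -> : i + k + i + k = i + i + (k + k) by lia.
by rewrite -[RHS]modnDmr kk modnDmr addn0.
Qed.

(** With the divisor d of few_residues, the residues modulo d of P below a
    are almost closed under addition, by the bound on the sums of least
    elements: two residues k with k + k missing would have least elements at
    least a / 2.  If they are closed, they are the multiples of a divisor e > 1 of
    d, and e = 2 since at most g / e elements of [1, g] are multiples of e.
    Otherwise there are two residues, 0 and i, and the sums of two elements,
    sorted by their residues 0, i and 2 i, give 3 r elements of P up to 2 g,
    more than the g + 1 that there are. *)
Lemma small_elements_even (P : pred nat) g r : P 0 ->
    (forall x y, P x -> P y -> P (x + y)) ->
    count P (iota 1 g) = r -> count P (iota 0 g.*2.+1) = g.+1 ->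
    g + 3 <= 3 * r ->
  forall x, x <= g -> P x -> ~~ odd x.
Proof.
move=> P0 PD Pr Pg gr.
have [a [d [[/andP[a0 ag] Pa amax Pra] d0 da few [k0 k0R]]]] :=
  few_residues P0 PD Pr Pg gr.
pose R := residue_hit P a d.
have R_mod k l : k = l %[mod d] -> R k = R l by exact: residue_hit_mod.
have RE s : s < a -> P s -> R s by move=> sa Ps; apply/residue_hitP; exists s.
have R0 : R 0 by apply: RE.
have least k : R k -> exists w, [/\ w < a, P w, w = k %[mod d] &
    forall s, P s -> s = k %[mod d] -> w <= s].
  case/residue_hitP => s [sa Ps sk].
  have ex : exists w, P w && (w == k %[mod d]) by exists s; rewrite Ps; apply/eqP.
  case: (ex_minnP ex) => w /andP[Pw /eqP wk] wmin; exists w; split => //.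
    by apply: leq_ltn_trans sa; apply: wmin; rewrite Ps; apply/eqP.
  by move=> t Pt tk; apply: wmin; rewrite Pt; apply/eqP.
have distinctD k l : k != l %[mod d] -> R k -> R l -> R (k + l).
  move=> kl Rk Rl; have [w [wa Pw wk wmin]] := least _ Rk.
  have [v [va Pv vl vmin]] := least _ Rl.
  have wva := least_sum_lt d0 da Pra few kl wa va wk vl Rk Rl wmin vmin.
  rewrite -(R_mod (w + v)); first by apply: RE => //; exact: PD.
  by rewrite -modnDm wk vl modnDm.
have bad_unique k l : R k -> R l -> ~~ R (k + k) -> ~~ R (l + l) -> k = l %[mod d].
  move=> Rk Rl; have [w [wa Pw wk wmin]] := least _ Rk.
  have [v [va Pv vl vmin]] := least _ Rl.
  have big u m : P u -> u = m %[mod d] -> ~~ R (m + m) -> a <= u + u.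
    move=> Pu um; rewrite leqNgt; apply: contra => uua.
    rewrite -(R_mod (u + u)); first by apply: RE => //; exact: PD.
    by rewrite -modnDm um modnDm.
  move=> /(big _ _ Pw wk) ww /(big _ _ Pv vl) vv; apply/eqP/negPn/negP => kl.
  have := least_sum_lt d0 da Pra few kl wa va wk vl Rk Rl wmin vmin.
  by move: ww vv; clear; lia.
have [RD|[i [Ri Rii only]]] := almost_closed d0 R0 R_mod distinctD bad_unique.
  have [e [e0 ed eR]] := periodic_closed d0 R0 RD (fun k => R_mod _ _ (modn_mod k d)).
  have e1 : e != 1 by apply: contraNneq k0R => e1; rewrite -/R eR e1 dvd1n.
  have eP y : y <= g -> P y -> e %| y.
    move=> yg Py; have := amax _ yg Py; rewrite leq_eqVlt => /predU1P[->|ya].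
      exact: dvdn_trans ed da.
    by rewrite -eR; apply: RE.
  have : r <= g %/ e.
    have Pe : {in iota 1 g, forall y, P y -> e %| y}.
      by move=> y; rewrite mem_iota => yg; apply: eP; lia.
    by rewrite -count_dvdn// (count_diff Pe) Pr leq_addr.
  have e2 : e <= 2 -> e = 2 by lia.
  have [/e2 E _|e3 rge] := leqP e 2.
    by move=> y yg Py; have := eP _ yg Py; rewrite E dvdn2.
  have : 3 * (g %/ e) <= g by have := leq_trunc_div g e; move: (g %/ e) e3 => q e3; nia.
  by move: rge gr; clear; lia.
have i_n0 : i != 0 %[mod d].
  apply/negP => /eqP i0E; move/negP: Rii; apply.
  by rewrite (R_mod _ 0)// -modnDm i0E modnDm.
have ii_n0 : i + i != 0 %[mod d].
  by apply/negP => /eqP e; move/negP: Rii; apply; rewrite (R_mod _ 0).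
have ii_ni : i + i != i %[mod d] by rewrite -{3}[i]addn0 eqn_modDl.
pose Y := filter P (iota 0 a.+1).
pose X0 := [seq x <- Y | x == 0 %[mod d]].
pose X1 := [seq x <- Y | ~~ (x == 0 %[mod d])].
have memY y : (y \in Y) = P y && (y <= a) by rewrite mem_filter mem_iota add0n ltnS.
have uY : uniq Y by rewrite filter_uniq ?iota_uniq.
have sX : size X0 + size X1 = r.+1.
  rewrite !size_filter (count_predC (fun x => x == 0 %[mod d])) size_filter /= P0.
  by rewrite -count_iota01 ?P0 ?Pa// Pra.
have X0P y : y \in X0 -> [/\ P y, y <= a & y = 0 %[mod d]].
  by rewrite mem_filter memY => /and3P[/eqP].
have X1P y : y \in X1 -> [/\ P y, y <= a & y = i %[mod d]].
  rewrite mem_filter memY => /and3P[y0 Py ya]; split=> //; apply: only => //.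
  apply: RE => //; rewrite ltn_neqAle ya andbT; apply: contra y0 => /eqP ->.
  by rewrite mod0n -/(dvdn d a).
have X0_0 : 0 \in X0 by rewrite mem_filter memY eqxx P0.
have X0_n : X0 != [::] by apply: contraTneq X0_0 => ->.
have [w [wa Pw wi _]] := least _ Ri.
have X1_w : w \in X1 by rewrite mem_filter memY wi i_n0 Pw ltnW.
have X1_n : X1 != [::] by apply: contraTneq X1_w => ->.
have [Z0 [uZ0 sZ0 Z0P]] := sums_lower (filter_uniq _ uY) (filter_uniq _ uY) X0_n X0_n.
have [Z1 [uZ1 sZ1 Z1P]] := sums_lower (filter_uniq _ uY) (filter_uniq _ uY) X0_n X1_n.
have [Z2 [uZ2 sZ2 Z2P]] := sums_lower (filter_uniq _ uY) (filter_uniq _ uY) X1_n X1_n.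
have {}Z0P z : z \in Z0 -> [/\ P z, z <= a + a & z = 0 %[mod d]].
  case/Z0P=> x [y [/X0P[Px xa xE] /X0P[Py ya yE] ->]]; split; first exact: PD.
    exact: leq_add.
  by rewrite -modnDm xE yE modnDm.
have {}Z1P z : z \in Z1 -> [/\ P z, z <= a + a & z = i %[mod d]].
  case/Z1P=> x [y [/X0P[Px xa xE] /X1P[Py ya yE] ->]]; split; first exact: PD.
    exact: leq_add.
  by rewrite -modnDm xE yE modnDm.
have {}Z2P z : z \in Z2 -> [/\ P z, z <= a + a & z = i + i %[mod d]].
  case/Z2P=> x [y [/X1P[Px xa xE] /X1P[Py ya yE] ->]]; split; first exact: PD.
    exact: leq_add.
  by rewrite -modnDm xE yE modnDm.
have uZ : uniq (Z0 ++ Z1 ++ Z2).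
  rewrite !cat_uniq uZ0 uZ1 uZ2 !andbT /=; apply/andP; split.
    apply/hasPn => z; rewrite mem_cat => zZ; apply/negP => /Z0P[_ _ z0].
    case/orP: zZ => [/Z1P|/Z2P] [_ _ zE]; first by rewrite -zE z0 eqxx in i_n0.
    by rewrite -zE z0 eqxx in ii_n0.
  apply/hasPn => z /Z2P[_ _ z2]; apply/negP => /Z1P[_ _ z1].
  by rewrite -z2 z1 eqxx in ii_ni.
have sZ : {subset Z0 ++ Z1 ++ Z2 <= filter P (iota 0 g.*2.+1)}.
  have aag : a + a < g.*2.+1 by move: ag; clear; lia.
  move=> z; rewrite !mem_cat mem_filter mem_iota add0n leq0n /=.
  by case/or3P=> [/Z0P|/Z1P|/Z2P] [-> za _] /=; apply: leq_ltn_trans za aag.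
have := uniq_leq_size uZ sZ; rewrite !size_cat size_filter Pg sZ0 sZ1 sZ2.
have : 0 < size X0 by case: (X0) X0_n.
have : 0 < size X1 by case: (X1) X1_n.
by move: sX gr; move: (size X0) (size X1) => m n; clear; lia.
Qed.

(** * Ordinarization numbers *)

From mathcomp Require Import finmap all_classical.
Import Order.TTheory Num.Theory.
Local Open Scope classical_set_scope.

Lemma uniq_eq_size (T : eqType) (s t : seq T) : uniq s -> uniq t -> s =i t ->
  size s = size t.
Proof. by move=> us ut st; exact/perm_size/uniq_perm. Qed.

Lemma genus_size (S : set nat) (L : seq nat) : uniq L ->
  (forall x, reflect (~ S x) (x \in L)) -> finite_set (gaps S) /\ genus S = size L.
Proof.
move=> uL LS; have LE : gaps S = [set` L].
  by apply/seteqP; split=> x /= /LS.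
have fS : finite_set (gaps S) by rewrite LE; exact: finite_seq.
split=> //; apply: uniq_eq_size => // x.
by rewrite in_fset_set// LE; apply/idP/idP; rewrite inE.
Qed.

Lemma count_gaps (S : set nat) N : numerical_semigroup S -> (genus S).*2 <= N ->
  count (fun x => x \notin S) (iota 0 N) = genus S.
Proof.
move=> SS gN; rewrite -size_filter; symmetry.
apply: (proj2 (genus_size _ _)); first by rewrite filter_uniq ?iota_uniq.
move=> x; rewrite mem_filter mem_iota add0n leq0n /=.
apply: (iffP andP) => [[/negP xS _] Sx|Sx]; first by apply: xS; rewrite inE.
split; first by apply/negP; rewrite inE.
by apply: leq_trans gN; exact: gaps_lt_double_genus.
Qed.

Lemma count_mem_semigroup (S : set nat) N : numerical_semigroup S -> (genus S).*2 <= N ->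
  count (fun x => x \in S) (iota 0 N) = N - genus S.
Proof.
move=> SS gN; have := count_predC (fun x => x \in S) (iota 0 N).
by rewrite size_iota [X in _ + X](count_gaps SS gN); lia.
Qed.

Definition small_count (S : set nat) : nat := count (fun x => x \in S) (iota 1 (genus S)).

Lemma small_countP (S : set nat) :
  reflect (exists x, 0 < x <= genus S /\ S x) (0 < small_count S).
Proof.
rewrite /small_count -has_count; apply: (iffP hasP) => [[x]|[x [xg Sx]]].
  by rewrite mem_iota => xg /set_mem Sx; exists x; split=> //; lia.
by exists x; [rewrite mem_iota; lia | exact/mem_set].
Qed.

(** There are as many gaps as numbers in [1, genus S], so an element in this
    interval is compensated by a gap above it. *)
Lemma gap_gt_genus (S : set nat) : numerical_semigroup S -> 0 < small_count S ->
  exists x, genus S < x /\ gaps S x.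
Proof.
move=> SS; apply: contraPP => noF; suff : small_count S = 0 by move=> ->.
have [S0 _ _] := SS.
have := count_mem_semigroup SS (leqnSn _); rewrite -addnn -addSn iotaD count_cat add0n.
have -> : count (fun x => x \in S) (iota (genus S).+1 (genus S)) = genus S.
  rewrite -[RHS](size_iota (genus S).+1); apply/eqP; rewrite -all_count.
  apply/allP => x; rewrite mem_iota => xg; apply/mem_set; apply: contrapT => Sx.
  by apply: noF; exists x; split=> //; lia.
by rewrite -[iota 0 _]/(0 :: iota 1 (genus S)) /= -/(small_count S) (mem_set S0); lia.
Qed.

Lemma ordinaryP (S : set nat) : numerical_semigroup S -> ordinary S <-> small_count S = 0.
Proof.
move=> SS; have [S0 _ _] := SS; split.
  move=> oS; apply/eqP; rewrite -leqn0 leqNgt; apply/negP => /small_countP[x [xg]].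
  by rewrite oS /=; lia.
move=> l0; apply/seteqP; split=> x /=.
  move=> Sx; have [->|x0] := eqVneq x 0; [by left|right; rewrite ltnNge].
  apply/negP => xg; suff : 0 < small_count S by rewrite l0.
  by apply/small_countP; exists x; split=> //; rewrite lt0n x0.
case=> [->//|gx]; apply: contrapT => Sx.
have := count_gaps SS (leqnSn _); rewrite -addnn -addSn iotaD count_cat add0n.
have := count_predC (fun x => x \in S) (iota 1 (genus S)).
rewrite -/(small_count S) l0 size_iota add0n /predC /= (mem_set S0) /= => ->.
have : 0 < count (fun x => x \notin S) (iota (genus S).+1 (genus S)).
  rewrite -has_count; apply/hasP; exists x; last by apply/negP => /set_mem.
  by rewrite mem_iota; have := gaps_lt_double_genus SS Sx; lia.
by lia.
Qed.

(** The multiplicity is at most the genus and the Frobenius number exceeds it, so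
    one element of [1, genus S] is lost and none is gained. *)
Lemma ordinarization_step (S : set nat) : numerical_semigroup S -> ~ ordinary S ->
  [/\ numerical_semigroup (ordinarization S), genus (ordinarization S) = genus S
    & small_count S = (small_count (ordinarization S)).+1].
Proof.
move=> SS nS; have [S0 SD fS] := SS; have l0 : 0 < small_count S.
  by rewrite lt0n; apply/eqP => /(ordinaryP SS).
have [Sm m0 mmin] := multiplicityP SS.
have [x [gx nSx]] := gap_gt_genus SS l0.
have [|nF Fmax] := frobeniusP SS; first by exists x.
have -> : ordinarization S = (S `\ multiplicity S) `|` [set frobenius S].
  by rewrite /ordinarization; case: pselect.
set m := multiplicity S in Sm m0 mmin *; set F := frobenius S in nF Fmax *.
set S' := _ `|` _.
have mg : m <= genus S.
  have /small_countP[y [yg Sy]] := l0; apply: leq_trans (mmin _ Sy _) _; lia.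
have gF : genus S < F by exact: leq_trans gx (Fmax _ nSx).
have S'E y : S' y <-> (S y /\ y <> m) \/ y = F by [].
have S'D y z : S' y -> S' z -> S' (y + z).
  have Fz u : S' u -> S' (F + u).
    move=> _; have [->|u0] := posnP u; first by rewrite addn0; right.
    left; split=> /=; last by lia.
    by apply: contrapT => /Fmax; lia.
  move=> [[Sy ym]|->] S'z; last exact: Fz.
  case: (S'z) => [[Sz zm]|->]; last by rewrite addnC; apply: Fz; left.
  left; split; first exact: SD.
  have [y0|y0] := eqVneq y 0; first by rewrite y0.
  have [z0|z0] := eqVneq z 0; first by rewrite z0 addn0.
  have := mmin _ Sy y0; have := mmin _ Sz z0; move=> /= mz my yz.
  by apply: ym; lia.
pose L : seq nat := m :: rem F (fset_set (gaps S)).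
have uL : uniq L.
  rewrite /= mem_rem_uniq ?fset_uniq// inE rem_uniq ?fset_uniq// andbT.
  by rewrite in_fset_set// negb_and; apply/orP; right; apply/negP => /set_mem; apply.
have LP y : reflect (~ S' y) (y \in L).
  rewrite inE mem_rem_uniq ?fset_uniq// inE in_fset_set//; apply: (iffP idP).
    move=> /predU1P[->|/andP[yF /set_mem nSy]] /S'E [[//]|yE].
    - by move: gF; rewrite -yE ltnNge mg.
    - by rewrite yE eqxx in yF.
  move=> nS'; have [//|ym] := eqVneq y m; rewrite /=; apply/andP; split.
    by apply/eqP => yF; apply: nS'; apply/S'E; right.
  by apply/mem_set => Sy; apply: nS'; apply/S'E; left; split=> //; exact/eqP.
have [fS' gS'] := genus_size uL LP.
have gE : genus S' = genus S.
  have Fin : F \in fset_set (gaps S) by rewrite in_fset_set//; exact/mem_set.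
  by rewrite gS' /= size_rem// prednK// -has_predT; apply/hasP; exists F.
split=> //.
  by split=> //; left; split=> //; apply/eqP; rewrite eq_sym.
rewrite /small_count gE.
rewrite (@count_diff (fun x => x \in S') (fun x => x \in S)); last first.
  move=> y; rewrite mem_iota => yg /set_mem/S'E[[Sy _]|yF]; first exact/mem_set.
  by lia.
rewrite -[RHS]addn1; congr addn.
rewrite (@eq_in_count _ _ (pred1 m)).
  by rewrite count_uniq_mem ?iota_uniq// mem_iota lt0n m0 add1n ltnS mg.
move=> y; rewrite mem_iota => yg /=; apply/andP/eqP => [[/set_mem Sy nS'y]|->].
  apply: contrapT => ym; move/negP: nS'y; apply; apply/mem_set/S'E; left; by split.
split; first exact/mem_set.
by apply/negP => /set_mem/S'E[[]//|mF]; lia.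
Qed.

Lemma ordinary_iter (S : set nat) i : numerical_semigroup S ->
  ordinary (iter i ordinarization S) <-> small_count S <= i.
Proof.
elim: i S => [|i IH] S SS; first by rewrite leqn0 /= (ordinaryP SS); split=> [->|/eqP].
rewrite iterSr; have [oS|nS] := pselect (ordinary S).
  have -> : ordinarization S = S by rewrite /ordinarization; case: pselect.
  by rewrite IH// (proj1 (ordinaryP SS) oS).
by have [S'S _ ->] := ordinarization_step SS nS; rewrite IH.
Qed.

Lemma ordinarization_numberP (S : set nat) r : numerical_semigroup S ->
  is_ordinarization_number S r <-> small_count S = r.
Proof.
move=> SS; rewrite /is_ordinarization_number ordinary_iter//; split.
  case=> lr rmin; apply/eqP; rewrite eqn_leq lr; apply: rmin.
  exact/ordinary_iter.
by move=> <-; split=> // i /ordinary_iter; apply.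
Qed.

(** * Semigroups built from an ideal of a semigroup *)

Definition ideal_pairs (n : nat) : seq (seq nat * seq nat) :=
  [seq (G, A) | G <- gapseqs n, A <- ideals G G predT].

Lemma size_ideal_pairs n : size (ideal_pairs n) = ideal_count n.
Proof. by rewrite size_allpairs_dep sumnE big_map. Qed.

Lemma ideal_pairs_uniq n : uniq (ideal_pairs n).
Proof.
apply: allpairs_uniq_dep; first exact: gapseqs_uniq.
  by move=> G; rewrite mem_gapseqs => /andP[/and3P[sG _ _] _]; exact: ideals_uniq.
by case=> [G A] [G' A'] _ _ /= [-> ->].
Qed.

Lemma ideal_pairsP n G A : reflect
  [/\ gapseq G, size G = n, subseq A G &
      forall x a, x \notin G -> a \in A -> a + x \in G -> a + x \in A]
  ((G, A) \in ideal_pairs n).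
Proof.
apply: (iffP allpairsPdep).
  move=> [G' [A' [+ + [-> ->]]]]; rewrite mem_gapseqs => /andP[gG /eqP sG].
  have sortG : sorted gtn G' by case/and3P: gG.
  case/(idealsP _ _ _ sortG) => AG _ upA; split=> // x a xG aA axG.
  apply/negPn/negP => axA; have [x0|x0] := posnP x; first by rewrite x0 addn0 aA in axA.
  have := upA _ _ axG axA aA; rewrite addKn (negbTE xG); apply/implyP/negP; lia.
case=> gG sG AG upA; exists G, A; rewrite mem_gapseqs gG sG eqxx; split=> //.
have sortG : sorted gtn G by case/and3P: gG.
apply/(@idealsP G G predT A sortG); split=> // b a bG bA aA ab.
apply/negPn/negP => baG; move/negP: bA; apply.
by have := upA _ _ baG aA; rewrite subnKC ?bG; [apply|exact: ltnW].
Qed.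

Lemma gapseqD G x y : gapseq G -> x \notin G -> y \notin G -> x + y \notin G.
Proof.
move=> gG xG yG; apply/negP => xyG; have [x0|x0] := posnP x; first by rewrite x0 add0n (negbTE yG) in xyG.
have [y0|y0] := posnP y; first by rewrite y0 addn0 (negbTE xG) in xyG.
by move/negP: yG; apply; rewrite -(addKn x y); apply: gapseq_sub => //; lia.
Qed.

Lemma gapseq_lt G x : gapseq G -> x \in G -> x < (size G).*2.
Proof.
move=> gG xG; have -> : (size G).*2 = size (G ++ [seq x - y | y <- G]).
  by rewrite size_cat size_map addnn.
rewrite -[x.+1](size_iota 0); apply: uniq_leq_size (iota_uniq _ _) _ => y.
rewrite mem_iota leq0n add0n ltnS /= => yx; rewrite mem_cat; case yG: (y \in G) => //=.
apply/mapP; exists (x - y); last by rewrite subKn.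
have [->|y0] := posnP y; first by rewrite subn0.
apply: gapseq_sub; rewrite ?yG// y0 ltn_neqAle yx andbT.
by apply: contraFneq yG => ->.
Qed.

Lemma count_even (p : pred nat) n :
  count (fun x => ~~ odd x && p x./2) (iota 1 n) = count p (iota 1 n./2).
Proof.
elim: n => // n IH; rewrite -[n.+1]addn1 iotaD count_cat IH /= addn1 addn0 /=.
rewrite uphalf_half negbK; move: n./2 => h {IH}; case: (odd n); last by rewrite add0n addn0.
by rewrite -[in RHS](addnC h) iotaD count_cat /= addn0.
Qed.

Lemma count_parity (p : pred nat) n :
  count p (iota 0 n.*2) =
    count (fun j => p j.*2) (iota 0 n) + count (fun j => p j.*2.+1) (iota 0 n).
Proof.
elim: n => // n IH; rewrite doubleS -[n.*2.+2]addn2 -[n.+1]addn1 !iotaD !count_cat IH.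
by rewrite /= !add0n; lia.
Qed.

(** The doubles 2 x of the elements x of the semigroup with gaps G, and the odd
    numbers 2 (t + j) + 1 for j in its ideal given by A. *)
Definition doubling (t : nat) (G A : seq nat) : set nat :=
  [set n | if odd n then (t <= n./2) && ((n./2 - t \notin G) || (n./2 - t \in A))
           else n./2 \notin G].

(** The number of odd gaps below the first odd element.  All uphalf g odd numbers
    up to g must be gaps, and r gaps must exceed g; of these,
    size G - size A come after the first odd element. *)
Definition odd_offset (g r : nat) (G A : seq nat) : nat :=
  uphalf g + (r - (size G - size A)).

Lemma doubling_odd t G A j : doubling t G A j.*2.+1 =
  ((t <= j) && ((j - t \notin G) || (j - t \in A))) :> Prop.
Proof. by rewrite /doubling /= odd_double /= uphalf_double. Qed.

Lemma doubling_even t G A j : doubling t G A j.*2 = (j \notin G) :> Prop.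
Proof. by rewrite /doubling /= odd_double doubleK. Qed.

Lemma parityP (n : nat) : (exists j, n = j.*2) \/ (exists j, n = j.*2.+1).
Proof.
rewrite -(odd_double_half n); case: (odd n); [right|left]; exists n./2 => //.
Qed.

Lemma size_filter_notin (A G : seq nat) : uniq G -> subseq A G ->
  size [seq x <- G | x \notin A] = size G - size A.
Proof.
move=> uG AG; have /eqP := esym (count_predC (mem A) G).
rewrite -size_filter; have /(subseq_uniqP uG) <- := AG.
by rewrite size_filter => /eqP ->; rewrite addKn.
Qed.

(** The sum of two odd elements is even and larger than 2 g, beyond the doubles of
    all the gaps in G. *)
Lemma doubling_semigroup g r G A : r <= g./2 -> g + 2 <= 3 * r ->
  (G, A) \in ideal_pairs (g./2 - r) ->
  semigroups_of g r (doubling (odd_offset g r G A) G A).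
Proof.
move=> rg gr /ideal_pairsP[gG sG AG upA].
set t := odd_offset g r G A; set S := doubling t G A.
have [sortG nG _] := and3P gG; have uG := gtn_sorted_uniq sortG.
have ltG x : x \in G -> x < (g./2 - r).*2 by rewrite -sG; exact: gapseq_lt.
have tg : uphalf g <= t by exact: leq_addr.
have gE := odd_double_half g; have ugE := uphalf_half g.
have sA := size_subseq AG.
pose L := [seq x.*2 | x <- G] ++ [seq x.*2.+1 | x <- iota 0 t] ++
          [seq (t + x).*2.+1 | x <- [seq x <- G | x \notin A]].
have LP x : reflect (~ S x) (x \in L).
  apply: (equivP idP); rewrite !mem_cat; have [[j ->]|[j ->]] := parityP x.
    rewrite /S doubling_even; split=> [|/negP/negPn jG].
      case/or3P=> /mapP[y yG /eqP]; last by [move=> /eqP e; lia | lia].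
      - by move=> /eqP/double_inj ->; rewrite yG.
      - by move=> /eqP e; lia.
    by apply/orP; left; apply: map_f.
  rewrite /S doubling_odd; split=> [|].
    case/or3P=> /mapP[y yG e].
    - by lia.
    - move: yG; rewrite mem_iota => yt; have -> : j = y by move: e; clear; lia.
      by move=> /andP[ty _]; move: yt ty; clear; lia.
    - have -> : j = t + y by lia.
      by move: yG; rewrite mem_filter addKn => /andP[/negbTE -> ->] /=; rewrite andbF.
  move/negP; rewrite negb_and negb_or negbK -ltnNge => H; apply/orP; right.
  case: (ltnP j t) H => [jt _|tj /= /andP[jG jA]]; apply/orP; [left|right].
    by apply: (map_f (fun x => x.*2.+1)); rewrite mem_iota.
  by apply/mapP; exists (j - t); rewrite ?mem_filter ?jA// subnKC.
have uL : uniq L.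
  rewrite !cat_uniq !map_inj_uniq ?filter_uniq ?iota_uniq ?uG//=; try by move=> ? ?; lia.
  rewrite andbT; apply/andP; split.
    apply/hasPn => x; rewrite mem_cat => xE; apply/negP => /mapP[y _ yE].
    by case/orP: xE => /mapP[z _ zE]; lia.
  apply/hasPn => _ /mapP[y _ ->]; apply/negP => /mapP[z]; rewrite mem_iota; lia.
have [fS gS] := genus_size uL LP.
have {}gS : genus S = g.
  rewrite gS !size_cat !size_map size_iota size_filter_notin// /t /odd_offset.
  by move: sG sA gE ugE rg gr; clear; lia.
have SS : numerical_semigroup S.
  split=> //.
  have idl a b : (a \notin G) -> (b \notin G) || (b \in A) ->
      (b + a \notin G) || (b + a \in A).
    move=> aG /orP[bG|bA]; first by rewrite gapseqD.
    by case baG: (b + a \in G) => //=; apply: upA.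
  move=> x y; have [[j ->]|[j ->]] := parityP x; have [[k ->]|[k ->]] := parityP y.
  - by rewrite -doubleD /S !doubling_even; exact: gapseqD.
  - rewrite addnS -doubleD /S doubling_even !doubling_odd => jG /andP[tk kE].
    rewrite (leq_trans tk (leq_addl _ _)) -addnBA// addnC; exact: idl.
  - rewrite addSn -doubleD /S doubling_even !doubling_odd => /andP[tj jE] kG.
    by rewrite (leq_trans tj (leq_addr _ _)) -addnBAC//; exact: idl.
  - rewrite addSn addnS -doubleD -doubleS /S doubling_even !doubling_odd.
    move=> /andP[tj _] /andP[tk _]; apply/negP => /ltG; lia.
split=> //; apply/(ordinarization_numberP _ SS); rewrite /small_count gS.
have -> : count (fun x => x \in S) (iota 1 g) =
          count (fun x => ~~ odd x && (x./2 \notin G)) (iota 1 g).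
  apply: eq_in_count => x; rewrite mem_iota => xg; have [[j xE]|[j xE]] := parityP x.
    rewrite xE odd_double doubleK /=; apply/idP/idP => [/set_mem|jG].
      by rewrite /S doubling_even.
    by apply/mem_set; rewrite /S doubling_even.
  rewrite xE /= odd_double /=; apply/negP => /set_mem; rewrite /S doubling_odd => /andP[tj _].
  lia.
rewrite (count_even (fun x => x \notin G)).
have := count_predC (fun x => x \in G) (iota 1 g./2); rewrite size_iota.
have -> : count (fun x => x \in G) (iota 1 g./2) = g./2 - r.
  rewrite -size_filter -sG; apply: uniq_eq_size => //; first by rewrite filter_uniq ?iota_uniq.
  move=> x; rewrite mem_filter mem_iota; case xG: (x \in G) => //=.
  have x0 : 0 < x by rewrite lt0n; apply: contraTneq xG => ->.
  by have := ltG _ xG; lia.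
by move=> E; apply: (@addnI (g./2 - r)); rewrite [LHS]E subnK.
Qed.

(** The offset can be read off the semigroup, as the integer part of half of its
    least odd element. *)
Lemma doubling_inj g r n :
  {in ideal_pairs n &, injective (fun GA => doubling (odd_offset g r GA.1 GA.2) GA.1 GA.2)}.
Proof.
move=> [G A] [G' A'] /ideal_pairsP[gG _ AG _] /ideal_pairsP[gG' _ AG' _] /=.
set t := odd_offset _ _ _ _; set t' := odd_offset _ _ _ _ => E.
have [sG nG _] := and3P gG; have [sG' nG' _] := and3P gG'.
have EG : G = G'.
  apply: gtn_sorted_eq => // x; apply: negb_inj; apply/idP/idP => xG.
    by rewrite -(doubling_even t' G' A') -E doubling_even.
  by rewrite -(doubling_even t G A) E doubling_even.
move: gG' AG' sG' nG' E; rewrite -{}EG => gG' AG' sG' nG' E.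
have Ett : t = t'.
  apply/eqP; rewrite eqn_leq.
  have : doubling t' G A' t.*2.+1 by rewrite -E doubling_odd leqnn subnn nG.
  have : doubling t G A t'.*2.+1 by rewrite E doubling_odd leqnn subnn nG.
  by rewrite !doubling_odd => /andP[-> _] /andP[-> _].
have EA : A = A'.
  have gtr : transitive gtn by move=> ? ? ? /= ? ?; lia.
  apply: gtn_sorted_eq; try exact: subseq_sorted sG.
  move=> x.
  have mem (B : seq nat) : doubling t G B (t + x).*2.+1 <-> (x \in B) || (x \notin G).
    by rewrite doubling_odd leq_addr addKn orbC.
  have [xG|xG] := boolP (x \in G); last first.
    have nin (B : seq nat) : subseq B G -> (x \in B) = false.
      by move=> /mem_subseq BG; apply: contraNF xG; exact: BG.
    by rewrite !nin.
  have := mem A; have := mem A'; rewrite xG !orbF E -Ett => e1 e2.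
  by apply/idP/idP => [/e2/e1|/e1/e2].
by rewrite EA.
Qed.

(** The elements of S up to g are even.  So the halves W of the even elements
    have h - r gaps up to h; that is too few to leave a gap above h, as the
    least such gap x would give a gap in each pair y, x - y.  The remaining
    gaps of S are odd, and counting them fixes the offset. *)
Lemma semigroups_of_doubling g r S : g + 3 <= 3 * r -> semigroups_of g r S ->
  r <= g./2 /\ exists2 GA, GA \in ideal_pairs (g./2 - r) &
                S = doubling (odd_offset g r GA.1 GA.2) GA.1 GA.2.
Proof.
move=> gr [SS gS /(ordinarization_numberP _ SS)]; rewrite /small_count gS => lowS.
have [S0 SD _] := SS.
pose P x := x \in S.
have PS x : P x <-> S x by split=> [/set_mem|/mem_set].
have PD x y : P x -> P y -> P (x + y) by rewrite !PS; exact: SD.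
have P0 : P 0 by apply/PS.
have Pg : count P (iota 0 g.*2.+1) = g.+1.
  by rewrite (count_mem_semigroup SS) gS//; lia.
have even := small_elements_even P0 PD lowS Pg gr.
pose Q x := P x.*2; set h := g./2.
have gE := odd_double_half g; have ugE := uphalf_half g.
have cQ : count Q (iota 1 h) = r.
  rewrite -lowS -count_even; apply: eq_in_count => x; rewrite mem_iota => xg.
  rewrite /Q; case xo: (odd x) => /=; last by rewrite even_halfK ?xo.
  by apply/esym/negP => /even; rewrite xo; apply/implyP/negP; lia.
have rh : r <= h by rewrite -cQ -[h in _ <= h](size_iota 1) count_size.
split=> //.
pose G := rev [seq x <- iota 1 h | ~~ Q x].
have memG0 x : (x \in G) = ~~ Q x && (0 < x <= h).
  by rewrite mem_rev mem_filter mem_iota; congr andb; lia.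
have sG : size G = h - r.
  rewrite size_rev size_filter; have := count_predC Q (iota 1 h); rewrite cQ size_iota => E.
  by apply: (@addnI r); rewrite [LHS]E subnKC.
have QD x y : Q x -> Q y -> Q (x + y) by rewrite /Q doubleD; exact: PD.
(* up to here G lists the gaps of W at most h; there are no others *)
have Qbig x : h < x -> Q x.
  move=> hx; apply/negPn/negP => nQx.
  have ex : exists x, (h < x) && ~~ Q x by exists x; rewrite hx.
  case: (ex_minnP ex) => {hx nQx}x /andP[hx nQx] xmin.
  have sub : {subset iota 1 x.-1 <= G ++ [seq x - y | y <- G]}.
    move=> y; rewrite mem_iota => yx; rewrite mem_cat.
    have inG z : 0 < z < x -> ~~ Q z -> z \in G.
      move=> zx nQz; rewrite memG0 nQz; case: (leqP z h); first by lia.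
      by move=> hz; have := xmin z; rewrite hz nQz => /(_ isT); lia.
    have [Qy|/inG -> //] := boolP (Q y); last by lia.
    apply/orP; right; apply/mapP; exists (x - y); last by lia.
    apply: inG; first by lia.
    by apply: contra nQx => /(QD _ _ Qy); rewrite subnKC//; lia.
  have := uniq_leq_size (iota_uniq _ _) sub.
  by rewrite size_iota size_cat size_map sG; lia.
have memG x : (x \in G) = ~~ Q x.
  rewrite memG0; case: (boolP (Q x)) => //= nQx.
  have [//|x0] := posnP x; first by move=> x0; rewrite x0 /Q double0 P0 in nQx.
  by rewrite leqNgt; apply: contra nQx; exact: Qbig.
have sortG : sorted gtn G.
  rewrite rev_sorted; apply: sorted_filter; last exact: iota_ltn_sorted.
  by move=> ? ? ?; exact: ltn_trans.
have uG := gtn_sorted_uniq sortG.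
have gapG : gapseq G.
  apply/and3P; split=> //; first by rewrite memG /Q double0 P0.
  apply/allP => x; rewrite memG => nQx; apply/indecomposableP => a ax.
  rewrite !memG -negb_and; apply: contra nQx => /andP[/QD Qa /Qa].
  by rewrite subnKC//; lia.
pose O j := P j.*2.+1.
have OQ j x : O j -> Q x -> O (j + x).
  by rewrite /O /Q doubleD -addSn; exact: PD.
have exO : exists j, O j.
  exists g; apply/PS; apply: contrapT => /(gaps_lt_double_genus SS); rewrite gS; lia.
case: (ex_minnP exO) => t Ot tmin.
have tg : uphalf g <= t.
  rewrite leqNgt; apply/negP => tg; have tg' : t.*2.+1 <= g by lia.
  by have := even _ tg' Ot; rewrite /= odd_double.
pose A := [seq x <- G | O (t + x)].
have memA x : (x \in A) = (x \in G) && O (t + x) by rewrite mem_filter andbC.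
have AG : subseq A G by exact: filter_subseq.
have sA := size_subseq AG.
have Ogap j : ~~ O j -> j < g.
  move=> nOj; have : gaps S j.*2.+1 by move=> /PS; apply/negP.
  by move=> /(gaps_lt_double_genus SS); rewrite gS; lia.
(* h - r of the g gaps of S are even *)
have cO : count (fun j => ~~ O j) (iota 0 g) = g - (h - r).
  have := count_gaps SS (leqnn _); rewrite gS count_parity.
  have -> : count (fun j => j.*2 \notin S) (iota 0 g) = h - r.
    rewrite -sG -size_filter; apply: uniq_eq_size; rewrite ?filter_uniq ?iota_uniq// => x.
    rewrite mem_filter mem_iota memG add0n leq0n -/(P _) -/(Q x) /=.
    case: (boolP (Q x)) => //= nQx; have : gaps S x.*2 by move=> /PS; apply/negP.
    by move=> /(gaps_lt_double_genus SS); rewrite gS ltn_double.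
  by move=> E; apply: (@addnI (h - r)); rewrite [LHS]E subnKC//; lia.
have tE : t = odd_offset g r G A.
  have : count (fun j => ~~ O j) (iota 0 g) = t + (size G - size A).
    rewrite -(size_filter_notin uG AG) -size_filter -[t in t + _](size_iota 0).
    rewrite -(size_map (addn t) [seq x <- G | x \notin A]) -size_cat; apply: uniq_eq_size.
    - by rewrite filter_uniq ?iota_uniq.
    - rewrite cat_uniq iota_uniq map_inj_uniq ?filter_uniq ?andbT//=; last exact: addnI.
      by apply/hasPn => _ /mapP[x _ ->]; rewrite mem_iota; lia.
    - move=> j; rewrite mem_filter mem_cat !mem_iota !add0n !leq0n /=.
      case: (ltnP j t) => [jt|tj] /=.
        have nOj : ~~ O j by apply: contraL jt => /tmin; rewrite -leqNgt.
        by rewrite nOj Ogap.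
      rewrite -{1 2}(subnKC tj); apply/andP/mapP => [[nO _]|[x + jE]].
        exists (j - t); last by rewrite subnKC.
        rewrite mem_filter memA (negbTE nO) andbF memG /=.
        by apply: contra nO; exact: OQ.
      rewrite mem_filter memA jE addKn => /andP[+ xG]; rewrite xG /= => nO.
      by split=> //; exact: Ogap.
  by rewrite cO /odd_offset sG => E; move: E sA sG rh gr gE ugE; clear; lia.
exists (G, A).
  apply/ideal_pairsP; split=> // x a; rewrite memG negbK => Qx; rewrite !memA.
  by move=> /andP[_ Oa] ->; rewrite addnA; exact: OQ.
rewrite /= -tE; apply/seteqP; split=> n; have [[j ->]|[j ->]] := parityP n.
- by move=> /PS Pj; rewrite doubling_even memG negbK.
- move=> /PS Oj; rewrite doubling_odd; have tj : t <= j by exact: tmin.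
  by rewrite tj memA subnKC// [O j]Oj andbT orNb.
- by rewrite doubling_even memG negbK => /PS.
rewrite doubling_odd memA => /andP[tj].
case: (boolP (j - t \in G)) => /= [_|]; first by rewrite subnKC// => /PS.
by rewrite memG negbK => /(OQ _ _ Ot) + _; rewrite subnKC// => /PS.
Qed.

Lemma n_le_ideal_count g r : g + 3 <= 3 * r ->
  n_ g r <= ideal_count (g./2 - r).
Proof.
move=> gr; rewrite -size_ideal_pairs.
rewrite -(size_map (fun GA => doubling (odd_offset g r GA.1 GA.2) GA.1 GA.2)).
apply: uniq_leq_size; first exact: fset_uniq.
move=> S; rewrite in_fset_set; last exact: finite_semigroups_of.
move=> /set_mem /(semigroups_of_doubling gr)[_ [GA GA_in ->]].
exact: map_f.
Qed.

Lemma ideal_count_le_n g r : r <= g./2 -> g + 2 <= 3 * r ->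
  ideal_count (g./2 - r) <= n_ g r.
Proof.
move=> rg gr; rewrite -size_ideal_pairs.
rewrite -(size_map (fun GA => doubling (odd_offset g r GA.1 GA.2) GA.1 GA.2)).
apply: uniq_leq_size.
  by rewrite map_inj_in_uniq ?ideal_pairs_uniq//; exact: doubling_inj.
move=> _ /mapP[[G A] GA ->]; rewrite in_fset_set; last exact: finite_semigroups_of.
by apply/mem_set; exact: doubling_semigroup.
Qed.

Lemma n_gt_half g r : g + 3 <= 3 * r -> g./2 < r -> n_ g r = 0.
Proof.
move=> gr rg; rewrite /n_ (_ : semigroups_of g r = set0) ?fset_set0//.
by rewrite -subset0 => S /(semigroups_of_doubling gr)[]; rewrite leqNgt rg.
Qed.

Theorem corollary14 (g r : nat) (hg : (0 < g)%N)
  (hr : (Num.max (g%:R / 3%:R + 1) (((g + 1) %/ 2)%N%:R - 14%:R)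
           <= r%:R :> rat)%R) :
  (n_ g r <= n_ g.+1 r)%N.
Proof.
have [gr r14] : g + 3 <= 3 * r /\ (g + 1) %/ 2 <= r + 14.
  move: hr; rewrite ge_max => /andP[h1 h2]; split; rewrite -(ler_nat rat) ?natrD ?natrM; lra.
rewrite divn2 addn1 in r14.
have [rg|rg] := leqP r g./2; last by rewrite n_gt_half.
apply: leq_trans (n_le_ideal_count gr) _.
(* (g + 1) / 2 - r is either g / 2 - r or, for odd g, its successor. *)
have hE := uphalf_half g; rewrite /= in r14.
apply: leq_trans (@ideal_count_le_n g.+1 r _ _); try by rewrite /=; lia.
move: r14; rewrite /= hE; case: (odd g) => // r14; rewrite add1n subSn//.
by apply: ideal_count_le; lia.
Qed.
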